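(* Let $G$ be a finite simple bipartite graph with bipartition $(A,B)$, $|A|=|B|=n$, and suppose $G$ is pseudo $2$--factor isomorphic. Then $G$ has a vertex of degree at most $\lfloor \log_2 n \rfloor + 2$.
   Context: A $2$--factor of a graph is a spanning $2$--regular subgraph (a spanning collection of vertex-disjoint cycles). A graph $G$ is pseudo $2$--factor isomorphic if $G$ has at least one $2$--factor and the parity of the number of cycles in a $2$--factor is the same for all $2$--factors of $G$. *)

(* Defs.v *)
From mathcomp Require Import all_boot.

Set Implicit Arguments.
Unset Strict Implicit.
Unset Printing Implicit Defensive.

(* A graph on the vertex set T is its adjacency relation. *)

Definition simple_graph (T : finType) (e : rel T) : Prop :=
  symmetric e /\ irreflexive e.

Definition degree (T : finType) (e : rel T) (x : T) : nat :=
  #|[set y | e x y]|.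

Definition bipartition (T : finType) (e : rel T) (A B : {set T}) : Prop :=
  [/\ A :|: B = [set: T],
      [disjoint A & B] &
      forall x y : T,
        e x y -> (x \in A) && (y \in B) || (x \in B) && (y \in A)].

(* A spanning subgraph is determined by its adjacency relation on all of T;
   irreflexivity of f follows from that of e. *)
Definition two_factor (T : finType) (e f : rel T) : Prop :=
  [/\ symmetric f, subrel f e & forall x : T, degree f x = 2].

(* The cycles of a 2-factor are its connected components. *)
Definition num_cycles (T : finType) (f : rel T) : nat := n_comp f [set: T].

Definition pseudo_2factor_isomorphic (T : finType) (e : rel T) : Prop :=
  (exists f : rel T, two_factor e f) /\
  (forall f g : rel T, two_factor e f -> two_factor e g ->
     odd (num_cycles f) = odd (num_cycles g)).

(* Main.v *)
(* If s is a permutation of the vertices with x ~ s x and s (s x) <> x, then the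
   edges {x, s x} form a 2-factor whose cycles are the orbits of s, so that the
   parity of their number is #|T| plus the signature of s. A bipartite 2-factor
   is oriented into such an s. If all degrees were at least log n + 3, every b in
   B would have more than log n vertices b' <> b of B with b ~ s b' and
   s (s b') <> b. A 2-colouring of B in which each b has such a b' of the other
   colour exists by a union bound; following these b' yields an even cycle t in
   B, and t * s gives a 2-factor of the opposite parity. *)
Require Import Defs.
From mathcomp Require Import all_boot all_fingroup.

Set Implicit Arguments.
Unset Strict Implicit.
Unset Printing Implicit Defensive.

(** * Pairs of fixed-point-free involutions *)

(** In the dihedral group generated by [u] and [v], the reflection [u (u v)^k] is conjugate to [u]
    or [v], so it has no fixed point in [D]. Conjugating by [u \o v] lowers [k] by two, hence the
    strong induction with two base cases. *)
Lemma involution_pair_iter_neq (X : finType) (D : {pred X}) (u v : X -> X) :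
    involutive u -> involutive v ->
    {in D, forall x, u x \in D} -> {in D, forall x, v x \in D} ->
    {in D, forall x, u x != x} -> {in D, forall x, v x != x} ->
  forall k, {in D, forall x, iter k (u \o v) x != u x}.
Proof.
move=> uK vK uD vD u_free v_free k.
elim/ltn_ind: k => [[|[|k]] IHk] x xD; first by rewrite eq_sym u_free.
  by rewrite /= (can_eq uK) v_free.
have x'D : u (v x) \in D by rewrite uD ?vD.
have: iter k (u \o v) (u (v x)) != u (u (v x)) by apply: IHk => //; rewrite ltnS leqW.
apply: contra => /eqP eq_iter; move: eq_iter.
rewrite iterS -[k.+1]addn1 iterD /= => /(can_inj uK) /(congr1 v).
by rewrite vK uK => ->.
Qed.

(* An orbit of the composite of the involutions never meets its image under
   either of them, so one orbit can be selected in each such pair. *)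
Lemma involution_pair_bicolor (X : finType) (D : {pred X}) (u v : X -> X) :
    involutive u -> involutive v ->
    {in D, forall x, u x \in D} -> {in D, forall x, v x \in D} ->
    {in D, forall x, u x != x} -> {in D, forall x, v x != x} ->
  exists K : pred X,
    {in D, forall x, K (u x) = ~~ K x} /\ {in D, forall x, K (v x) = ~~ K x}.
Proof.
move=> uK vK uD vD u_free v_free.
pose w := u \o v; have w_inj : injective w by apply: inj_comp; apply: can_inj.
have w_sym : connect_sym (frel w) by apply: fconnect_sym.
have root1 x : froot w (w x) = froot w x.
  by apply/eqP; rewrite root_connect // -(same_fconnect1 w_inj).
have root_u : {in D, forall x, froot w (u x) != froot w x}.
  move=> x xD; rewrite root_connect // w_sym; apply/negP => /iter_findex => eq_ux.
  by have := involution_pair_iter_neq uK vK uD vD u_free v_free (findex w x (u x)) xD;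
     rewrite eq_ux eqxx.
have root_v x : froot w (v x) = froot w (u x).
  by rewrite -(root1 (v x)) /w /= vK.
have K_u x : x \in D ->
    (enum_rank (froot w (u x)) < enum_rank (froot w x)) =
    ~~ (enum_rank (froot w x) < enum_rank (froot w (u x))).
  move=> xD; rewrite -leqNgt ltn_neqAle.
  by rewrite (inj_eq val_inj) (inj_eq enum_rank_inj) root_u.
(* Of the two distinct orbits through [x] and [u x], the one whose root has the smaller rank is
   selected. The orbit of [v x] is that of [u x], because [w (v x) = u x]. *)
exists (fun x => enum_rank (froot w x) < enum_rank (froot w (u x))).
split=> x xD; first by rewrite uK K_u.
have root_uv : froot w (u (v x)) = froot w x by exact: root1.
by rewrite root_uv root_v K_u.
Qed.

(** * From permutations to 2-factors *)

Section PermTwoFactor.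

Variables (T : finType) (s : {perm T}).

Definition cycle_graph : rel T := fun x y => (s x == y) || (s y == x).

Lemma connect_cycle_graph : connect cycle_graph =2 fconnect s.
Proof.
have s_sym := fconnect_sym (@perm_inj _ s).
move=> x y; apply/idP/idP; apply: connect_sub => {x y} x y.
  by case/orP=> /eqP <-; [|rewrite s_sym]; apply: fconnect1.
by move=> /= /eqP <-; apply: connect1; rewrite /cycle_graph eqxx.
Qed.

Lemma num_cycles_cycle_graph : num_cycles cycle_graph = #|porbits s|.
Proof.
have s_sym := fconnect_sym (@perm_inj _ s).
have porbitE x y : (y \in porbit s x) = fconnect s x y.
  apply/porbitP/idP => [[i ->]|/iter_findex <-]; first by rewrite permX fconnect_iter.
  by exists (findex s x y); rewrite permX.
rewrite /num_cycles (eq_n_comp connect_cycle_graph) /n_comp_mem.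
have porbit_inj : {in froots s &, injective (porbit s)}.
  move=> x y /eqP rx /eqP ry eq_xy; rewrite -rx -ry; apply/eqP.
  by rewrite root_connect // -porbitE eq_xy porbit_id.
rewrite -(card_in_imset (f := porbit s)); last first.
  by move=> x y /andP[rx _] /andP[ry _]; apply: porbit_inj.
congr #|pred_of_set _|; apply/setP => O; apply/imsetP/imsetP => -[x _ ->].
  by exists x.
exists (froot s x); first by rewrite !inE roots_root.
by apply/eqP; rewrite eq_porbit_mem porbit_sym porbitE connect_root.
Qed.

Lemma odd_num_cycles_cycle_graph :
  odd (num_cycles cycle_graph) = odd #|T| (+) odd_perm s.
Proof. by rewrite num_cycles_cycle_graph /odd_perm addbA addbb. Qed.

Lemma two_factor_cycle_graph (e : rel T) :
    symmetric e -> (forall x, e x (s x)) -> (forall x, s (s x) != x) ->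
  two_factor e cycle_graph.
Proof.
move=> e_sym e_s s2; split=> [x y|x y|x]; first by rewrite /cycle_graph orbC.
  by case/orP=> /eqP <-; rewrite // e_sym.
rewrite /degree.
have -> : [set y | cycle_graph x y] = [set s x; (s^-1)%g x].
  apply/setP=> y; rewrite !inE /cycle_graph [s x == y]eq_sym.
  by rewrite (can2_eq (permK s) (permKV s)).
(* At the predecessor of [x], [s2] says that the successor and the predecessor of [x] differ. *)
rewrite cards2; have := s2 ((s^-1)%g x); rewrite permKV.
by move=> ->.
Qed.

End PermTwoFactor.

(** * Orienting a bipartite 2-factor *)

Section Orientation.

Variables (T : finType) (f : rel T).
Hypotheses (f_sym : symmetric f) (f_deg : forall x, degree f x = 2).

(** The default [y] makes [other_nbr x] fix the non-neighbours of [x], hence an involution on all of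
    [T]. *)
Definition other_nbr x y := odflt y [pick z | f x y && f x z && (z != y)].

Lemma other_nbrP x y : f x y ->
  [/\ f x (other_nbr x y), other_nbr x y != y &
      forall z, f x z -> z != y -> z = other_nbr x y].
Proof.
move=> fxy; have /eqP/cards2P[a [b [neq_ab nbrE]]] := f_deg x.
have fE z : f x z = (z == a) || (z == b) by have /setP/(_ z) := nbrE; rewrite !inE.
rewrite /other_nbr; case: pickP => [z /= /andP[/andP[_ fxz] neq_zy]|no].
  split=> // t; move: fxy fxz neq_zy; rewrite !fE.
  by do 2![case/orP=> /eqP ->]; rewrite ?eqxx // => _ /orP[] /eqP ->; rewrite ?eqxx.
move: (no a) (no b); rewrite fxy !fE !eqxx orbT /= => /negbFE/eqP eq_ay /negbFE/eqP eq_by.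
by rewrite eq_ay eq_by eqxx in neq_ab.
Qed.

Lemma other_nbrK x : involutive (other_nbr x).
Proof.
move=> y; have [fxy|nfxy] := boolP (f x y); last first.
  have oy : other_nbr x y = y by rewrite /other_nbr (negPf nfxy); case: pickP.
  by rewrite !oy.
have [fxz neq_zy _] := other_nbrP fxy.
by have [_ _ /(_ y fxy)] := other_nbrP fxz; rewrite eq_sym => /(_ neq_zy).
Qed.

(** Exchanging one end of an ordered edge for the other neighbour of the opposite end gives two
    fixed-point-free involutions. Ordered pairs are coloured because an odd cycle has no alternating
    colouring of its edges. *)
Lemma edge_bicolor : exists K : rel T, forall x y, f x y ->
  K x (other_nbr x y) = ~~ K x y /\ K (other_nbr y x) y = ~~ K x y.
Proof.
pose D := [pred p : T * T | f p.1 p.2].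
pose u (p : T * T) := (p.1, other_nbr p.1 p.2).
pose v (p : T * T) := (other_nbr p.2 p.1, p.2).
have vP p : p \in D -> [/\ v p \in D & v p != p].
  case: p => x y; rewrite !inE /= => fxy; have fyx : f y x by rewrite f_sym.
  by have [fyz neq_zx _] := other_nbrP fyx; rewrite f_sym fyz xpair_eqE negb_and neq_zx.
have uP p : p \in D -> [/\ u p \in D & u p != p].
  case: p => x y; rewrite !inE /= => fxy.
  by have [fyz neq_zx _] := other_nbrP fxy; rewrite fyz xpair_eqE eqxx neq_zx.
have [||||||K [Ku Kv]] := @involution_pair_bicolor _ D u v.
- by case=> x y; rewrite /u /= other_nbrK.
- by case=> x y; rewrite /v /= other_nbrK.
- by move=> p /uP[].
- by move=> p /vP[].
- by move=> p /uP[].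
- by move=> p /vP[].
by exists (fun x y => K (x, y)) => x y fxy; split; [apply: Ku (x, y) _|apply: Kv (x, y) _].
Qed.

Lemma exists_cycle_perm (A : {set T}) :
    (forall x y, f x y -> (y \in A) = (x \notin A)) ->
  exists s : {perm T}, (forall x, f x (s x)) /\ (forall x, s (s x) != x).
Proof.
move=> f_bip; have [K K_other] := edge_bicolor.
(* With each edge read from [A], [K] splits [f] into two perfect matchings: one is followed out of
   [A], the other back into [A]. *)
pose R x y := f x y && (if x \in A then K x y else ~~ K y x).
have R_ex x : exists y, R x y.
  have [y] : exists y, y \in [set y | f x y].
    by apply/card_gt0P; have := f_deg x; rewrite /degree => ->.
  rewrite inE => fxy; have fyx : f y x by rewrite f_sym.
  have [fxz _ _] := other_nbrP fxy.
  have [Kx _] := K_other x y fxy; have [_ Ky] := K_other y x fyx.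
  have [/andP Rxy|nRxy] := boolP (R x y); first by exists y; apply/andP.
  exists (other_nbr x y); move: nRxy; rewrite /R fxy fxz /= Kx Ky.
  by case: ifP.
have R_inj x1 x2 y : R x1 y -> R x2 y -> x1 = x2.
  case/andP=> f1 R1 /andP[f2 R2]; apply/eqP; apply: contraTT isT => neq_12.
  have f1' : f y x1 by rewrite f_sym.
  have f2' : f y x2 by rewrite f_sym.
  have [_ _ /(_ x2 f2')] := other_nbrP f1'; rewrite eq_sym => /(_ neq_12) x2E.
  move: R1 R2; rewrite -[x1 \in A]negbK -(f_bip _ _ f1) -[x2 \in A]negbK -(f_bip _ _ f2).
  have [_ K1] := K_other _ _ f1; have [K2 _] := K_other _ _ f1'.
  by rewrite x2E K1 K2; case: (y \in A) => /= ->.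
have s_inj : injective (fun x => xchoose (R_ex x)).
  move=> x1 x2 /= eq_12; apply: (R_inj _ _ (xchoose (R_ex x1))); first exact: xchooseP.
  by rewrite eq_12; apply: xchooseP.
have sR x : R x (perm s_inj x) by rewrite permE; apply: xchooseP.
exists (perm s_inj); split=> x; first by case/andP: (sR x).
(* Returning along the same edge would give that edge both colours. *)
apply/negP => /eqP eq_x; have := sR (perm s_inj x); have := sR x; rewrite eq_x.
case/andP=> fxy Rxy /andP[_]; rewrite (f_bip _ _ fxy).
by move: Rxy; case: (x \in A) => /= [->|/negP].
Qed.

End Orientation.


(** * Colourings and alternating cycles *)

(* Union bound over the 2-colourings C: those constant on [i |: N i] are
   determined by [C :\: N i]. *)
Lemma nonconstant_coloring (T I : finType) (B : {set I}) (p : I -> T)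
    (N : I -> {set T}) (k : nat) :
    #|B| < 2 ^ k -> (forall i, i \in B -> p i \notin N i) ->
    (forall i, i \in B -> k <= #|N i|) ->
  exists C : {set T}, forall i, i \in B ->
    exists2 y, y \in N i & (y \in C) = (p i \notin C).
Proof.
move=> ltBk pN leN.
pose bad i := [set C : {set T} | [forall y in N i, (y \in C) == (p i \in C)]].
have card_bad i : i \in B -> #|bad i| * 2 ^ k <= 2 ^ #|T|.
  move=> iB; have inj_bad : {in bad i &, injective (fun C => C :\: N i)}.
    move=> C C'; rewrite !inE => /forall_inP bC /forall_inP bC' eq_CC'.
    have eq_p : (p i \in C) = (p i \in C').
      by have /setP/(_ (p i)) := eq_CC'; rewrite !inE (negPf (pN i iB)).
    apply/setP=> y; have [yN|yN] := boolP (y \in N i).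
      by rewrite (eqP (bC y yN)) (eqP (bC' y yN)).
    by have /setP/(_ y) := eq_CC'; rewrite !inE (negPf yN).
  rewrite -(card_in_imset inj_bad) -(cardsC (N i)) addnC expnD.
  apply: leq_mul; last by rewrite leq_exp2l // leN.
  rewrite -card_powerset subset_leq_card //; apply/subsetP => _ /imsetP[C _ ->].
  by rewrite inE setDE subsetIr.
have [C Cgood] : exists C, C \notin \bigcup_(i in B) bad i.
  apply/existsP; rewrite -negb_forall; apply/forallP => all_bad.
  have: 2 ^ #|T| * 2 ^ k <= #|B| * 2 ^ #|T|.
    have -> : 2 ^ #|T| = #|\bigcup_(i in B) bad i|.
      rewrite -cardsT -card_powerset; apply: eq_card => C.
      by rewrite all_bad inE subsetT.
    apply: (@leq_trans ((\sum_(i in B) #|bad i|) * 2 ^ k)).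
      rewrite leq_mul2r; apply/orP; right.
      elim/big_rec2: _ => [|i m U _ leUm]; first by rewrite cards0.
      by rewrite (leq_trans (leq_card_setU _ _)) ?leq_add2l.
    rewrite big_distrl -sum_nat_const; apply: leq_sum => i iB.
    apply: leq_trans (card_bad i iB) _.
    rewrite -cardsT -card_powerset; apply: subset_leq_card; apply/subsetP => C _.
    exact: all_bad.
  by rewrite mulnC leq_mul2r expn_eq0 /= leqNgt ltBk.
exists C => i iB; have: C \notin bad i by apply: contra Cgood => bC; apply/bigcupP; exists i.
rewrite inE => /forall_inPn[y yN neq_y]; exists y => //.
by move: neq_y; case: (y \in C); case: (p i \in C).
Qed.

(* A minimal nonempty [h]-stable set is a single cycle of [h], and [h]
   exchanges its two colour classes. *)
Lemma odd_perm_of_alternating_map (T : finType) (B C : {set T}) (h : T -> T) :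
    B != set0 -> {in B, forall x, h x \in B} ->
    {in B, forall x, (h x \in C) = (x \notin C)} ->
  exists t : {perm T}, [/\ odd_perm t,
    {in B, forall x, t x = x \/ t x = h x} & {in ~: B, forall x, t x = x}].
Proof.
move=> B0 hB hC.
pose stable (S : {set T}) := [&& S != set0, S \subset B & h @: S \subset S].
have [|S /minsetP[/and3P[S0 /subsetP SB hS] Smin] _] := @minset_exists _ stable B.
  by rewrite /stable B0 subxx; apply/subsetP => _ /imsetP[x xB ->]; apply: hB.
(* The image of a stable set is stable, so by minimality [h] permutes [S]. *)
have hS_eq : h @: S = S.
  apply: Smin => //; rewrite /stable (subset_trans hS) ?imsetS ?andbT //; last exact/subsetP.
  by have /set0Pn[x xS] := S0; apply/set0Pn; exists (h x); apply: imset_f.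
have h_inj : {in S &, injective h} by apply/imset_injP; rewrite hS_eq.
have hSin x : x \in S -> h x \in S by move=> xS; rewrite -hS_eq imset_f.
pose g x := if x \in S then h x else x.
have g_inj : injective g.
  move=> x y; rewrite /g; case: ifPn => xS; case: ifPn => yS //.
  - exact: h_inj.
  - by move=> eq_y; rewrite -eq_y hSin in yS.
  - by move=> eq_x; rewrite eq_x hSin in xS.
pose t := perm g_inj.
have tS x : x \in S -> t x = h x by rewrite permE /g => ->.
have tNS x : x \notin S -> t x = x by rewrite permE /g => /negPf ->.
have porbit_out x : x \notin S -> porbit t x = [set x].
  move=> xS; apply/setP => y; rewrite inE; apply/porbitP/eqP => [[i ->]|->]; last by exists 0; rewrite perm1.
  by rewrite permX; elim: i => //= i ->; apply: tNS.
have porbit_in x : x \in S -> porbit t x = S.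
  move=> xS; have sub : porbit t x \subset S.
    apply/subsetP => _ /porbitP[i ->]; rewrite permX.
    by elim: i => //= i IHi; rewrite tS // hSin.
  apply: Smin => //; rewrite /stable (subset_trans sub) ?andbT; last exact/subsetP.
  apply/andP; split; first by apply/set0Pn; exists x; apply: porbit_id.
  apply/subsetP => _ /imsetP[y yx ->]; rewrite -tS ?(subsetP sub) //.
  have /porbitP[i ->] := yx.
  by rewrite -permM -expgSr mem_porbit.
have porbitsE : porbits t = S |: [set [set x] | x in ~: S].
  apply/setP => O; rewrite in_setU1; apply/imsetP/orP => [[x _ ->]|[/eqP ->|/imsetP[x]]].
  - have [xS|xS] := boolP (x \in S); first by left; rewrite porbit_in.
    by right; rewrite porbit_out // imset_f // inE.
  - by have /set0Pn[x xS] := S0; exists x; rewrite ?porbit_in.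
  by rewrite inE => xS ->; exists x; rewrite ?porbit_out.
have S_even : ~~ odd #|S|.
  have leh (P Q : {set T}) : {subset P <= S} -> {in P, forall x, h x \in Q} -> #|P| <= #|Q|.
    move=> PS PQ; rewrite -(card_in_imset (sub_in2 PS h_inj)) subset_leq_card //.
    by apply/subsetP => _ /imsetP[x xP ->]; apply: PQ.
  rewrite -(cardsID C S); suff -> : #|S :&: C| = #|S :\: C| by rewrite addnn odd_double.
  apply/eqP; rewrite eqn_leq !leh // => x; rewrite !inE => /andP[] //.
  - by move=> ? xS; rewrite hSin ?hC ?SB.
  - by move=> xS xC; rewrite hSin ?hC ?SB ?xC.
exists t; split=> [|x xB|x]; last by rewrite inE => xB; apply: tNS; apply: contra xB; apply: SB.
  have SN : S \notin [set [set x] | x in ~: S].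
    apply/imsetP => -[x]; rewrite inE => xS SE; by rewrite SE set11 in xS.
  (* There are [1 + #|~: S|] orbits on [#|S| + #|~: S|] points, so the sign has the parity of
     [#|S| + 1]. *)
  rewrite /odd_perm porbitsE cardsU1 SN (card_imset _ set1_inj) -(cardsC S).
  by rewrite !oddD (negPf S_even) /= addbN addbb.
by have [xS|xS] := boolP (x \in S); [right; apply: tS | left; apply: tNS].
Qed.

(** * Switching the parity *)

Theorem theorem2p5 (T : finType) (e : rel T) (A B : {set T}) (n : nat)
    (n_gt0 : 0 < n)
    (e_simple : simple_graph e)
    (e_bip : bipartition e A B)
    (cardA : #|A| = n) (cardB : #|B| = n)
    (e_pseudo : pseudo_2factor_isomorphic e) :
  exists x : T, degree e x <= trunc_log 2 n + 2.
Proof.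
have [e_sym _] := e_simple; have [_ dAB e_AB] := e_bip.
have [[f [f_sym fe f_deg]] parity] := e_pseudo.
have eNB x y : e x y -> (y \in B) = (x \notin B).
  move=> /e_AB; have := disjointFr dAB; move=> dis /orP[] /andP[x1 y1].
    by rewrite y1 dis.
  by rewrite x1 dis.
have [|s [f_s s2]] := exists_cycle_perm f_sym f_deg (A := B).
  by move=> x y /fe; apply: eNB.
have e_s x : e x (s x) by apply: fe.
apply/existsP; rewrite -[X in is_true X]negbK negb_exists; apply/negP => /forallP deg_gt.
(* [N x] holds the admissible values [y != x] for [t x]: the edge from [x] to [s y] exists and does
   not close up into a 2-cycle. *)
pose N x := [set y | e x (s y) && (s (s y) != x)] :\ x.
have [|x _|x xB|C C_N] := @nonconstant_coloring T T B id N (trunc_log 2 n).+1.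
- by rewrite cardB trunc_log_ltn.
- by rewrite !inE eqxx.
(* Only two neighbours of [x] are not reached from [N x]: [s x], whose preimage is [x] itself, and
   the predecessor of [x], which would close a 2-cycle. So [N x] has at least [degree e x - 2]
   elements. *)
- have: #|[set y | e x y]| <= #|s @: N x :|: [set s x; (s^-1)%g x]|.
    apply: subset_leq_card; apply/subsetP => y; rewrite !inE => exy.
    have [->|neq1] := eqVneq y (s x); first by rewrite orbT.
    have [->|neq2] := eqVneq y ((s^-1)%g x); first by rewrite !orbT.
    rewrite !orbF; apply/imsetP; exists ((s^-1)%g y); last by rewrite permKV.
    rewrite !inE permKV exy (can2_eq (permKV s) (permK s)) neq1 /=.
    by rewrite (can2_eq (permK s) (permKV s)).
  move=> /leq_trans/(_ (leq_card_setU _ _)); rewrite (card_imset _ perm_inj) cards2.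
  have := deg_gt x; rewrite -ltnNge => /leq_trans lt /lt.
  rewrite addn2 => /leq_trans -/(_ (#|N x| + 2)); rewrite addn2 !ltnS; apply.
  by rewrite -addn2 leq_add2l; case: (_ != _).
pose h x := odflt x [pick y in N x | (y \in C) == (x \notin C)].
have hP x : x \in B -> h x \in N x /\ (h x \in C) = (x \notin C).
  move=> xB; rewrite /h; case: pickP => [y /andP[yN /eqP yC]|no] //.
  by have [y yN yC] := C_N x xB; have := no y; rewrite yN yC eqxx.
have [|x xB|x xB|t [t_odd tB tNB]] := @odd_perm_of_alternating_map T B C h.
- by rewrite -card_gt0 cardB.
(* [s (h x)] is adjacent to both [x] and [h x], which therefore lie on the same side. *)
- have [] := hP x xB; rewrite !inE => /and3P[_ e_h _] _.
  by rewrite -[_ \in B]negbK -(eNB _ _ (e_s _)) (eNB _ _ e_h) xB.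
- by case: (hP x xB).
have tsP x : x \in B -> e x (s (t x)) /\ s (s (t x)) != x.
  move=> xB; have [->|->] := tB x xB; first by rewrite e_s s2.
  by have [] := hP x xB; rewrite !inE => /and3P[_ -> ->].
have e_ts x : e x ((t * s)%g x).
  rewrite permM; have [/tsP[]|xB] := boolP (x \in B); first by [].
  by rewrite tNB ?inE.
(* From [x] in [B], [t * s] leads outside [B], where [t] is the identity, so two steps give
   [s (s (t x))]. A vertex outside [B] is handled next through its image in [B]. *)
have ts2B x : x \in B -> (t * s)%g ((t * s)%g x) != x.
  move=> xB; rewrite permM [(t * s)%g x]permM [t (s _)]tNB; first by case: (tsP x xB).
  by rewrite inE (eNB x) ?xB //; case: (tsP x xB).
have ts2 x : (t * s)%g ((t * s)%g x) != x.
  have [/ts2B//|xB] := boolP (x \in B).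
  by rewrite -(inj_eq (@perm_inj _ (t * s)%g)) ts2B // (eNB x).
have := parity _ _ (two_factor_cycle_graph e_sym e_s s2) (two_factor_cycle_graph e_sym e_ts ts2).
rewrite !odd_num_cycles_cycle_graph odd_permM t_odd.
by case: (odd #|T|); case: (odd_perm s).
Qed.
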